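(* There are infinite families of regular maps which have square-free Euler characteristic of the form $-n(n-2)$ or $-n(n-3)$ with $n$ a positive integer; that is, for each of the two forms $-n(n-2)$ and $-n(n-3)$ there is an infinite family of regular maps whose Euler characteristics are square-free and of that form for positive integers $n$.
   Context: A map $\mathcal{M}=(V,E,F)$ is a 2-cell embedding of a (multi)graph into a closed surface with vertex set $V$, edge set $E$ and face set $F$; its Euler characteristic is $\chi(\mathcal{M})=|V|-|E|+|F|$. A flag is an incident triple (vertex, edge, face). A map is regular if its automorphism group acts regularly on flags; such a map is determined by a regular triple $(x,y,z)$ of its automorphism group $G$, i.e. $G=\langle x,y,z\rangle$, $|x|=|y|=|z|=2$, $\langle x,z\rangle\cong\mathbb{Z}_2^2$, with vertex, edge and face stabilizers $\langle x,y\rangle$, $\langle x,z\rangle$, $\langle y,z\rangle$ respectively. A (nonzero) integer is square-free if it is not divisible by the square of a prime. *)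

(* Defs.v *)
From HB Require Import structures.
From mathcomp Require Import all_boot all_order all_algebra all_fingroup.

Set Implicit Arguments.
Unset Strict Implicit.
Unset Printing Implicit Defensive.

Import Order.TTheory GRing.Theory Num.Theory.

Local Open Scope group_scope.

(* A 2-cell embedding of a finite (multi)graph with at least one edge into a
   closed surface, orientable or not, encoded by its flags (the corners of the
   barycentric subdivision). The flag adjacent to f with the same
   - vertex and edge is rx f (only the face changes),
   - vertex and face is ry f (only the edge changes),
   - edge and face is rz f (only the vertex changes);
   a "change" may lead back to the same cell, approached from another side or end.
   Freeness of the involutions says that the surface has no boundary, each edge
   has exactly the four flags f, rx f, rz f, rz (rx f), and transitivity says
   that the surface is connected and the flag set is nonempty. *)
Record surface_map := SurfaceMap {
  flag : finType;
  rx : {perm flag};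
  ry : {perm flag};
  rz : {perm flag};
  rx_invol : forall f, rx (rx f) = f;
  ry_invol : forall f, ry (ry f) = f;
  rz_invol : forall f, rz (rz f) = f;
  rx_free : forall f, rx f != f;
  ry_free : forall f, ry f != f;
  rz_free : forall f, rz f != f;
  rxz_comm : forall f, rx (rz f) = rz (rx f);
  rxz_free : forall f, rx (rz f) != f;
  flag_connected : [transitive <<[set rx; ry; rz]>>, on [set: flag] | 'P]
}.

Definition vertices (M : surface_map) : {set {set flag M}} :=
  orbit 'P <<[set rx M; ry M]>> @: [set: flag M].
Definition edges (M : surface_map) : {set {set flag M}} :=
  orbit 'P <<[set rx M; rz M]>> @: [set: flag M].
Definition faces (M : surface_map) : {set {set flag M}} :=
  orbit 'P <<[set ry M; rz M]>> @: [set: flag M].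

Definition euler_char (M : surface_map) : int :=
  (#|vertices M|%:Z - #|edges M|%:Z + #|faces M|%:Z)%R.

(* Automorphisms are the flag permutations preserving all three adjacencies,
   i.e. commuting with rx, ry and rz. *)
Definition map_aut (M : surface_map) : {group {perm flag M}} :=
  'C([set rx M; ry M; rz M])%G.

Definition regular_map (M : surface_map) : Prop :=
  [transitive map_aut M, on [set: flag M] | 'P] /\
  (forall f : flag M, 'C_(map_aut M)[f | 'P] = 1).

Definition square_free (m : int) : Prop :=
  m <> 0%R /\ forall p : nat, prime p -> ~~ ((p ^ 2)%N %| m)%Z.

(* Main.v *)
(* If n is odd, D_m x D_n is generated by x = (a1, 1), y = (b1, b2) and
   z = (1, a2), where D_m = <a1, b1> and D_n = <a2, b2>, and the resulting
   regular map has Euler characteristic n gcd(m, 2) - m n + m.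
   - For m = n this is - n (n - 2).
   - For m = j + 2 and n = 4 j + 3 with j even, it is - N (N - 3), N = 2 j + 2.
   With n = 6 i + 7 and j = 6 i + 6 the values are - (6 i + 7) (6 i + 5) and
   - 2 (6 i + 7) (12 i + 11), with pairwise coprime factors, and it remains to
   find infinitely many i for which two linear forms in i, with values coprime
   to 6, are both square-free.  By a sieve the proportion of bad i is at most
   2 (1 / 5 ^ 2 + 1 / 6 ^ 2 + ...) < 2 / 4. *)
Require Import Defs.
From HB Require Import structures.
From mathcomp Require Import all_boot all_order all_algebra all_fingroup.
From mathcomp Require Import all_solvable zify.

Set Implicit Arguments.
Unset Strict Implicit.
Unset Printing Implicit Defensive.

Import Order.TTheory GRing.Theory Num.Theory.

(** * Square-free values of linear forms *)

Definition sqfree (m : nat) : bool := all (fun p => ~~ (p ^ 2 %| m)) (primes m).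

Lemma sqfreeP (m : nat) : 0 < m ->
  reflect (forall p, prime p -> ~~ (p ^ 2 %| m)) (sqfree m).
Proof.
move=> m0; apply: (iffP allP) => h p; last first.
  by rewrite mem_primes => /and3P[/h].
move=> pp; apply/negP => pm; have /negP[] // : ~~ (p ^ 2 %| m).
by apply: h; rewrite mem_primes pp m0 (dvdn_trans _ pm) // dvdn_exp.
Qed.

Lemma sqfreeM (m n : nat) : 0 < m -> 0 < n -> coprime m n ->
  sqfree m -> sqfree n -> sqfree (m * n).
Proof.
move=> m0 n0 cmn /(sqfreeP m0) sm /(sqfreeP n0) sn; apply/sqfreeP; first by rewrite muln_gt0 m0.
move=> p pp; apply/negP => pmn.
have : p %| m * n by rewrite (dvdn_trans _ pmn) // dvdn_exp.
rewrite Euclid_dvdM // => /orP[pm|pn].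
  have /negP[] := sm p pp; rewrite -(@Gauss_dvdl _ _ n) //.
  by rewrite coprimeXl // (coprime_dvdl pm).
have /negP[] := sn p pp; rewrite -(@Gauss_dvdr _ m) //.
by rewrite coprimeXl // coprime_sym (coprime_dvdr pn).
Qed.

Lemma square_free_opp_nat (m : nat) : 0 < m -> sqfree m -> square_free (- m%:Z)%R.
Proof.
move=> m0 /(sqfreeP m0) sm; split=> [|p /sm]; first by lia.
by rewrite dvdzE abszN.
Qed.

(** Two solutions in the same block of [q] consecutive integers are congruent modulo [q], hence
    equal; so [i %/ q] is injective on the solutions. *)
Lemma count_dvd_progression (q a b X : nat) : 0 < q -> coprime q a ->
  \sum_(i < X) (q %| a * i + b) <= X %/ q + 1.
Proof.
move=> q0 cqa; pose A := [set i : 'I_X | q %| a * i + b].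
have -> : \sum_(i < X) (q %| a * i + b) = #|A|.
  by rewrite -sum1_card [RHS]big_mkcond; apply: eq_bigr => i _; rewrite inE; case: (q %| _).
have quot_lt (i : 'I_X) : i %/ q < X %/ q + 1.
  by rewrite addn1 ltnS leq_div2r // ltnW.
rewrite -[_ + 1]card_ord; apply: (@leq_card_in _ _ (fun i => Ordinal (quot_lt i))) => i j.
wlog le_ij : i j / i <= j => [W iA jA eq_ij|].
  have [/W|/ltnW/W W'] := leqP i j; first exact.
  by apply/esym/W'.
rewrite !inE => iA jA [eq_ij]; apply/val_inj => /=.
have : q %| a * (j - i) by rewrite mulnBr -(subnDr b) dvdn_sub.
rewrite Gauss_dvdr // -eqn_mod_dvd // => /eqP eq_m.
by rewrite (divn_eq i q) (divn_eq j q) eq_ij eq_m.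
Qed.

(* Sum of [1 / d^2 < 1 / (d - 1) - 1 / d], with floors. *)
Lemma sum_div_squares (X D : nat) : 5 <= D ->
  \sum_(5 <= d < D) X %/ d ^ 2 + X %/ D.-1 <= X %/ 4.
Proof.
elim: D => // D IHD; rewrite leq_eqVlt => /orP[/eqP <-|]; first by rewrite big_geq.
(* The new term is absorbed because [(1 / D + 1 / D ^ 2) * (D - 1) = 1 - 1 / D ^ 2]. *)
rewrite ltnS => D5; apply: leq_trans (IHD D5).
rewrite big_nat_recr //= -addnA leq_add2l leq_divRL; last by lia.
have := leq_trunc_div X (D ^ 2); have := leq_trunc_div X D.
move: (X %/ D) (X %/ D ^ 2) => u v; case: D D5 {IHD} => // D _ /=.
rewrite -(leq_pmul2r (m := D.+1)) // => h1 h2.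
rewrite -(leq_pmul2r (m := D.+1 ^ 2)) //.
nia.
Qed.

(** A prime whose square divides the value cannot divide [a], else it would divide [b] too. As
    [6 %| a], it is neither 2 nor 3. *)
Lemma not_sqfree_square_dvd (a b i D : nat) : 6 %| a -> coprime a b ->
  0 < a * i + b < D ^ 2 -> ~~ sqfree (a * i + b) ->
  exists2 d, 5 <= d < D & coprime d a && (d ^ 2 %| a * i + b).
Proof.
move=> a6 cab /andP[m0 mD] /allPn[p]; rewrite mem_primes => /and3P[pp _ pm].
rewrite negbK => p2m; have cpa : coprime p a.
  rewrite prime_coprime //; apply/negP => pa; move: pm.
  rewrite dvdn_addr ?dvdn_mulr // => pb.
  have : p %| gcdn a b by rewrite dvdn_gcd pa.
  by rewrite (eqP cab) dvdn1 => /eqP p1; rewrite p1 in pp.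
exists p; last by rewrite cpa.
rewrite -(ltn_sqr p) (leq_ltn_trans (dvdn_leq m0 p2m) mD) andbT.
have {}cpa := coprime_dvdr a6 cpa.
by case: p pp cpa {pm p2m} => [|[|[|[|[|p]]]]].
Qed.

(** After exchanging the sums, each [d] contributes at most [X %/ d ^ 2 + 1]; the units add up to at
    most [D]. *)
Lemma sum_count_squares (a b X D : nat) : 5 <= D ->
  \sum_(i < X) \sum_(5 <= d < D) (coprime d a && (d ^ 2 %| a * i + b)) <= X %/ 4 + D.
Proof.
move=> D5; rewrite exchange_big /=.
apply: (@leq_trans (\sum_(5 <= d < D) (X %/ d ^ 2 + 1))).
  rewrite big_nat_cond [X in _ <= X]big_nat_cond; apply: leq_sum => d /andP[/andP[d5 _] _].
  have [cda|_] /= := boolP (coprime d a); last by rewrite big1.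
  by apply: count_dvd_progression; rewrite ?expn_gt0 ?coprimeXl //; lia.
rewrite big_split sum_nat_const_nat muln1 /=.
by rewrite leq_add ?leq_subr // (leq_trans (leq_addr _ _) (sum_div_squares X D5)).
Qed.

(** If every [i] from [K] up to [X] failed, counting square divisors for both forms would give
    [X <= K + 2 * (X / 4 + D)]. This is false for large [X], since [D] need only grow like the
    square root of [X]. *)
Lemma sqfree_progressions (a b a' b' K : nat) :
  6 %| a -> 6 %| a' -> coprime a b -> coprime a' b' -> 0 < b -> 0 < b' ->
  exists2 i, K <= i & sqfree (a * i + b) && sqfree (a' * i + b').
Proof.
move=> a6 a6' cab cab' b0 b0'; pose c := a + b + a' + b'.
(* [D ^ 2] exceeds [c ^ 2 * X], hence every value of both forms at [i < X]; [N] is large enough that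
   [N ^ 2 > 2 * (K + 2 * D)]. *)
pose N := 4 * c + 2 * K + 9; pose X := N ^ 2; pose D := c * N + 1.
have [/existsP[i /andP[Ki si]]|] := boolP [exists i : 'I_X,
    (K <= i) && (sqfree (a * i + b) && sqfree (a' * i + b'))].
  by exists i.
rewrite negb_exists => /forallP bad.
pose hit u v (i : nat) := \sum_(5 <= d < D) (coprime d u && (d ^ 2 %| u * i + v)).
have hit_ge1 u v (i : 'I_X) : 6 %| u -> coprime u v -> 0 < v -> u + v <= c ->
    ~~ sqfree (u * i + v) -> 1 <= hit u v i.
  move=> u6 cuv v0 uv ns; have fD : 0 < u * i + v < D ^ 2.
    rewrite addn_gt0 v0 orbT /=; apply: (@leq_trans (c ^ 2 * X).+1).
      rewrite ltnS (@leq_trans ((u + v) * X)) //.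
        rewrite mulnDl; apply: leq_add; last by rewrite leq_pmulr // (leq_trans _ (ltn_ord i)).
        by rewrite leq_mul2l (ltnW (ltn_ord i)) orbT.
      rewrite leq_mul2r (leq_trans uv) ?orbT // leq_pmulr // (leq_trans _ uv) //.
      by rewrite addn_gt0 v0 orbT.
    by rewrite -expnMn /D addn1 ltn_sqr.
  have [d dD ok] := not_sqfree_square_dvd u6 cuv fD ns.
  by rewrite /hit (bigD1_seq d) /= ?mem_index_iota ?iota_uniq ?ok.
(* Each [i] is either below [K] or counted by a square divisor of one of its two values. *)
have : \sum_(i < X) 1 <= \sum_(i < X) ((i < K) + (hit a b i + hit a' b' i)).
  apply: leq_sum => i _; have := bad i; have [//|_] := ltnP i K.
  rewrite /= negb_and add0n => /orP[ns|ns].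
    by apply: leq_trans (hit_ge1 a b i a6 cab b0 _ ns) (leq_addr _ _); rewrite /c; lia.
  by apply: leq_trans (hit_ge1 a' b' i a6' cab' b0' _ ns) (leq_addl _ _); rewrite /c; lia.
rewrite big_split big_split /= sum_nat_const card_ord muln1.
have lK : \sum_(i < X) (i < K) <= K.
  rewrite -(big_mkord xpredT (fun i => (i < K) : nat)) /=.
  have [XK|KX] := leqP X K.
    apply: leq_trans XK; rewrite -[X in _ <= X]subn0 -[X in _ <= X]muln1 -sum_nat_const_nat.
    by apply: leq_sum => i _; case: (_ < _).
  rewrite (big_cat_nat (n := K)) ?(ltnW KX) //= [X in _ + X]big_nat_cond [X in _ + X]big1.
    rewrite addn0 -[X in _ <= X]subn0 -[X in _ <= X]muln1 -sum_nat_const_nat.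
    by apply: leq_sum => i _; case: (_ < _).
  by move=> i; rewrite andbT => /andP[Ki _]; rewrite ltnNge Ki.
have D5 : 5 <= D.
  by rewrite /D addn1 ltnS (@leq_trans (2 * 2)) // leq_mul // /c /N; lia.
have h1 := sum_count_squares a b X D5; have h2 := sum_count_squares a' b' X D5.
rewrite /hit => h.
have {}h : X <= K + ((X %/ 4 + D) + (X %/ 4 + D)).
  by apply: leq_trans h _; rewrite !leq_add.
have {}h : X <= 2 * (K + 2 * D) by move: (leq_trunc_div X 4) h; lia.
have c1 : 1 <= c by rewrite /c; lia.
have /negP[] : ~~ (X <= 2 * (K + 2 * D)); last exact: h.
rewrite -ltnNge /X expnS expn1 {1}/N !mulnDl /D /N; nia.
Qed.

(** Each term is chosen beyond the previous one, so the sequence is strictly increasing. *)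
Lemma unbounded_injective_sequence (P : pred nat) :
  (forall K, exists2 i, K <= i & P i) ->
  exists2 s : nat -> nat, injective s & forall k, P (s k).
Proof.
move=> unb; pose f K : nat := s2val (sig2W (unb K)).
have fK K : K <= f K by rewrite /f; case: sig2W.
have Pf K : P (f K) by rewrite /f; case: sig2W.
pose s := fix s k := if k is k'.+1 then f (s k').+1 else f 0.
exists s; last by case=> [|k]; apply: Pf.
have incr_s : {homo s : i j / i < j}.
  by apply: homo_ltn => [|k]; [exact: ltn_trans | exact: fK].
by move=> i j eq_s; case: (ltngtP i j) => // /incr_s; rewrite eq_s ltnn.
Qed.

(** * Groups generated by two involutions *)

Section DihedralMaps.
Local Open Scope group_scope.

Lemma involutions_gen_mul (gT : finGroupType) (x y : gT) :
  x ^+ 2 = 1 -> y ^+ 2 = 1 ->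
  <<[set x; y]>> = <[x * y]> * <[x]> /\ (x * y) ^ x = (x * y)^-1.
Proof.
move=> x2 y2; have xV : x^-1 = x by apply/eqP; rewrite eq_invg_mul -x2.
have yV : y^-1 = y by apply/eqP; rewrite eq_invg_mul -y2.
have cJ : (x * y) ^ x = (x * y)^-1 by rewrite conjgE invMg yV !mulgA mulVg mul1g xV.
split=> //; rewrite -norm_joinEr; last first.
  by rewrite cycle_subG; apply/normP; rewrite -cycleJ cJ cycleV.
apply/eqP; rewrite eqEsubset gen_subG subUset !sub1set; apply/andP; split.
  rewrite mem_gen ?inE ?cycle_id ?orbT //= -[X in X \in _](mulKg x y).
  by rewrite groupM ?groupV ?mem_gen ?inE ?cycle_id ?orbT.
by rewrite join_subG !cycle_subG groupM ?mem_gen ?set21 ?set22.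
Qed.

(** The factors [<[x * y]>] and [<[x]>] meet trivially: if [x] were a power of [x * y], it would
    both centralize and invert [x * y], so [x * y] would have order at most 2, forcing [x = 1] or
    [y = 1]. *)
Lemma card_involutions_gen (gT : finGroupType) (x y : gT) :
  #[x] = 2 -> #[y] = 2 -> #|<<[set x; y]>>| = (2 * #[(x * y)%g])%N.
Proof.
move=> ox oy.
have [x2 y2] : x ^+ 2 = 1 /\ y ^+ 2 = 1 by rewrite -{1}ox -oy !expg_order.
have [-> cJ] := involutions_gen_mul x2 y2.
rewrite TI_cardMg; first by rewrite -!orderE ox mulnC.
apply/eqP/trivgPn=> -[u /setIP[cu]]; rewrite /= cycle2g // => /set2P[->|ux].
  by rewrite eqxx.
move=> _; rewrite {}ux {u} /= in cu.
have xc : commute (x * y) x by apply: (centsP (cycle_abelian (x * y))); rewrite ?cycle_id.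
have c2 : (x * y) ^+ 2 = 1.
  by apply/eqP; rewrite expgS expg1 -eq_invg_mul -cJ conjgE xc mulKg.
move: cu; have [c1|/eqP c1] := eqVneq (x * y) 1.
  by rewrite c1 cycle1 inE => /eqP x1; move: ox; rewrite x1 order1.
have oc : #[x * y] = 2 by apply: nt_prime_order => //; apply/eqP.
rewrite cycle2g // !inE => /orP[/eqP x1|]; first by move: ox; rewrite x1 order1.
by rewrite -[X in X == _]mulg1 (inj_eq (mulgI _)) => /eqP y1; move: oy; rewrite -y1 order1.
Qed.

Lemma dihedral_involutions (q : nat) : (1 < q)%N ->
  {gT : finGroupType & {ab : gT * gT |
    [/\ #[ab.1] = 2, #[ab.2] = 2, #[ab.1 * ab.2] = q
      & <<[set ab.1; ab.2]>> = [set: gT]]}}.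
Proof.
move=> q1; exists ('D_(q.*2))%type.
have /isoGrp_hom/= : [set: 'D_(q.*2)] \isog Grp (x : y : x ^+ 2, y ^+ 2, (x * y) ^+ q).
  exact: Grp'_dihedral.
case/existsP/sigW=> -[a b]; rewrite /= !xpair_eqE /= => /and4P[/eqP gen /eqP a2 /eqP b2 /eqP abq].
exists (a, b) => /=.
have gen' : <<[set a; b]>> = [set: 'D_(q.*2)] by rewrite -gen joing_idl joing_idr.
have oD := card_dihedral q1.
have [gM _] := involutions_gen_mul a2 b2.
have le2 (u : 'D_(q.*2)) : u ^+ 2 = 1 -> (#[u] <= 2)%N.
  by move=> u2; rewrite dvdn_leq // order_dvdn u2.
have oab : #[a * b] = q.
  apply/eqP; rewrite eqn_leq dvdn_leq ?order_dvdn ?abq ?(ltnW q1) //=.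
  (* The presentation only bounds the orders from above; the group order [2 * q] forces equality. *)
  have : (#|[set: 'D_(q.*2)]| <= #[a * b] * #[a])%N.
    by rewrite -gen' gM !orderE mul_cardG leq_pmulr // cardG_gt0.
  rewrite oD => /leq_trans/(_ (leq_mul (leqnn _) (le2 a a2))).
  by rewrite muln2 leq_double.
have big (u : 'D_(q.*2)) : u ^+ 2 = 1 -> [set: 'D_(q.*2)] != <[u]>.
  move=> u2; apply/negP => /eqP e; have := le2 u u2.
  by rewrite orderE -e oD -[2]/(1.*2) leq_double leqNgt q1.
split=> //; apply: nt_prime_order => //; apply/eqP => e.
  by have /negP[] := big b b2; rewrite -gen e cycle1 joing1G.
by have /negP[] := big a a2; rewrite -gen e cycle1 joingG1.
Qed.

(** * The regular map of a regular triple *)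

Section RegularCover.
Variables (gT : finGroupType) (x y z : gT).
Hypotheses (ox : #[x] = 2) (oy : #[y] = 2) (oz : #[z] = 2).
Hypotheses (xz : commute x z) (x_neq_z : x != z).
Hypothesis gen_xyz : <<[set x; y; z]>> = [set: gT].

(* Flags are the elements of the group; adjacencies are right translations, so
   that automorphisms are left translations. *)
Let rho : gT -> {perm gT} := actperm 'R.

Let rhoE g f : rho g f = f * g. Proof. exact: actpermE. Qed.

Let invol g : #[g] = 2 -> forall f, rho g (rho g f) = f.
Proof. by move=> og f; rewrite !rhoE -mulgA -[g * g](expgS g 1) -og expg_order mulg1. Qed.

Let free g : g != 1 -> forall f, rho g f != f.
Proof. by move=> g1 f; rewrite rhoE -{2}[f]mulg1 (inj_eq (mulgI _)). Qed.

Let free2 g : #[g] = 2 -> forall f, rho g f != f.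
Proof. by move=> og; apply: free; rewrite -order_gt1 og. Qed.

Let comm f : rho x (rho z f) = rho z (rho x f).
Proof. by rewrite !rhoE -!mulgA xz. Qed.

Let freexz f : rho x (rho z f) != f.
Proof.
rewrite !rhoE -mulgA -rhoE; apply: free.
rewrite -eq_invg_mul invg_expg oz /= expg1 eq_sym //.
Qed.

Let rho_gen (A : {set gT}) : <<rho @: A>> = actperm 'R @* <<A>>.
Proof. by rewrite morphim_gen ?subsetT // morphimEsub ?subsetT. Qed.

Let rho3 : [set rho x; rho y; rho z] = rho @: [set x; y; z].
Proof. by rewrite !imsetU !imset_set1. Qed.

Let conn : [transitive <<[set rho x; rho y; rho z]>>, on [set: gT] | 'P].
Proof.
rewrite rho3 rho_gen gen_xyz; apply/imsetP; exists 1; first by rewrite inE.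
by rewrite orbit_morphim_actperm ?subsetT // orbitR lcoset1.
Qed.

Definition regular_cover : surface_map :=
  SurfaceMap (invol ox) (invol oy) (invol oz) (free2 ox) (free2 oy) (free2 oz)
    comm freexz conn.

(** Under right translations by a subgroup [H], the orbit of [f] is the left coset [f H]. *)
Let card_cells (u v : gT) :
  #|orbit 'P <<[set rho u; rho v]>> @: [set: gT]| = (#|gT| %/ #|<<[set u; v]>>|)%N.
Proof.
have -> : orbit 'P <<[set rho u; rho v]>> @: [set: gT] = lcosets <<[set u; v]>> [set: gT].
  apply: eq_imset => f; rewrite lcosetE -orbitR.
  rewrite -(@orbit_morphim_actperm _ _ _ 'R) ?subsetT //.
  by rewrite -rho_gen imsetU !imset_set1.
by rewrite card_lcosets -divgS ?subsetT // cardsT.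
Qed.

Lemma euler_char_regular_cover :
  euler_char regular_cover =
  ((#|gT| %/ (2 * #[(x * y)%g]))%:Z - (#|gT| %/ 4)%:Z + (#|gT| %/ (2 * #[(y * z)%g]))%:Z)%R.
Proof.
rewrite /euler_char /vertices /edges /faces /= !card_cells !card_involutions_gen //.
(* The edge group then has order [2 * 2]. *)
suff -> : #[x * z] = 2 by [].
apply: nt_prime_order => //; first by rewrite expgMn // -{1}ox -oz !expg_order mulg1.
by rewrite -eq_invg_mul invg_expg ox.
Qed.

(** Commuting with the three generating translations means commuting with all of them, so
    automorphisms are exactly the left translations, which act regularly on the group. *)
Lemma regular_cover_regular : regular_map regular_cover.
Proof.
have autP (u : {perm gT}) :
    reflect (forall f g, u (f * g) = u f * g) (u \in map_aut regular_cover).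
  rewrite /map_aut /= rho3 -cent_gen rho_gen gen_xyz; apply: (iffP centP) => [cu f g|cu v].
    have /cu/permP/(_ f) : rho g \in actperm 'R @* [set: gT] by rewrite mem_morphim ?inE.
    by rewrite !permM !rhoE.
  by case/morphimP=> g _ _ ->; apply/permP=> f; rewrite !permM !rhoE.
split=> [|f].
  apply/imsetP; exists (1 : gT); first by rewrite inE.
  apply/setP=> g; rewrite inE; apply/esym/imsetP; exists (perm (mulgI g)).
    by apply/autP=> h k; rewrite !permE mulgA.
  by rewrite /= /aperm permE mulg1.
apply/eqP; rewrite eqEsubset sub1G andbT; apply/subsetP=> u /setIP[/autP au /astab1P uf].
rewrite inE; apply/eqP/permP=> g; rewrite perm1.
have {1}-> : g = (f : gT) * (f^-1 * g) by rewrite mulKVg.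
by rewrite au; move: uf; rewrite /= /aperm => ->; rewrite mulKVg.
Qed.

End RegularCover.

(** * Maps from products of two dihedral groups *)

Lemma expg_pair (gT rT : finGroupType) (g : gT) (h : rT) k :
  (g, h) ^+ k = (g ^+ k, h ^+ k).
Proof. by elim: k => // k IHk; rewrite !expgS IHk. Qed.

Lemma order_pair (gT rT : finGroupType) (g : gT) (h : rT) :
  #[(g, h)] = lcmn #[g] #[h].
Proof.
apply/eqP; rewrite eqn_dvd dvdn_lcm !order_dvdn expg_pair -pair_eqE /=.
rewrite -!order_dvdn dvdn_lcml dvdn_lcmr /= !order_dvdn.
have /eqP := expg_order (g, h); rewrite expg_pair -pair_eqE /= => /andP[-> ->] //.
Qed.

(** The group has order [4 * m * n], [x * y] has order [lcmn m 2] and [y * z] has order [2 * n],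
    giving [n * gcdn m 2] vertices, [m * n] edges and [m] faces. The existential lives in [Type] so
    that a family of maps can be defined by projection. *)
Lemma dihedral_product_map (m n : nat) : (1 < m)%N -> (1 < n)%N -> odd n ->
  {M : surface_map | regular_map M &
    euler_char M = ((n * gcdn m 2)%:Z - (m * n)%:Z + m%:Z)%R}.
Proof.
move=> m1 n1 n_odd.
have [gT1 [[a1 b1] /= [oa1 ob1 oc1 gen1]]] := dihedral_involutions m1.
have [gT2 [[a2 b2] /= [oa2 ob2 oc2 gen2]]] := dihedral_involutions n1.
pose gT : finGroupType := (gT1 * gT2)%type.
pose x : gT := (a1, 1); pose y : gT := (b1, b2); pose z : gT := (1, a2).
have ox : #[x] = 2 by rewrite order_pair oa1 order1.
have oy : #[y] = 2 by rewrite order_pair ob1 ob2.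
have oz : #[z] = 2 by rewrite order_pair oa2 order1.
have xz : commute x z by congr pair; rewrite ?mulg1 ?mul1g.
have x_neq_z : x != z.
  by rewrite xpair_eqE -order_eq1 oa1.
have oxy : #[x * y] = lcmn m 2.
  by rewrite -oc1 -ob2 -order_pair; congr (order (_, _)); rewrite mul1g.
have oba : #[b2 * a2] = n.
  by rewrite -oc2 -(orderJ (a2 * b2) a2) conjgE !mulgA mulVg mul1g.
have oyz : #[y * z] = lcmn 2 n.
  by rewrite -ob1 -oba -order_pair; congr (order (_, _)); rewrite mulg1.
have gen_xyz : <<[set x; y; z]>> = [set: gT].
  set G := <<_>>.
  have [xG yG zG] : [/\ x \in G, y \in G & z \in G].
    by split; rewrite mem_gen // !inE eqxx ?orbT.
  have b12 : b1 ^+ 2 = 1 by rewrite -ob1 expg_order.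
  have b1G : (b1, 1) \in G.
    (* Oddness of [n] separates the two components of [y]: the power [n] kills [b2 * a2] but fixes
       the involution [b1]. *)
    suff -> : (b1, 1) = (y * z) ^+ n by rewrite groupX // groupM.
    have -> : y * z = (b1, b2 * a2) by congr pair; rewrite mulg1.
    rewrite expg_pair -{2}oba expg_order; congr (_, _).
    by rewrite -(odd_double_half n) n_odd add1n -mul2n expgS expgM b12 expg1n mulg1.
  have b2G : (1, b2) \in G.
    have -> : (1, b2) = (b1, 1)^-1 * y by congr pair; rewrite /= ?mulVg ?invg1 ?mul1g.
    by rewrite groupM // groupV.
  have sub1 : @pairg1 gT1 gT2 @* <<[set a1; b1]>> \subset G.
    rewrite morphim_gen ?subsetT // gen_subG morphimEsub ?subsetT // imsetU !imset_set1.
    by rewrite subUset !sub1set xG.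
  have sub2 : @pair1g gT1 gT2 @* <<[set a2; b2]>> \subset G.
    rewrite morphim_gen ?subsetT // gen_subG morphimEsub ?subsetT // imsetU !imset_set1.
    by rewrite subUset !sub1set zG.
  apply/eqP; rewrite eqEsubset subsetT /=; apply/subsetP=> -[g h] _.
  have -> : (g, h) = @pairg1 gT1 gT2 g * @pair1g gT1 gT2 h by congr pair; rewrite ?mulg1 ?mul1g.
  apply: groupM; [apply: (subsetP sub1); rewrite gen1 | apply: (subsetP sub2); rewrite gen2].
    exact: mem_morphim.
  exact: mem_morphim.
pose M := regular_cover ox oy oz xz x_neq_z gen_xyz.
exists M; first exact: regular_cover_regular.
rewrite euler_char_regular_cover oxy oyz card_prod -!cardsT -gen1 -gen2.
rewrite !card_involutions_gen // oc1 oc2 mulnACA.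
have lg := muln_lcm_gcd m 2; have lg' := muln_lcm_gcd 2 n.
rewrite (_ : gcdn 2 n = 1)%N ?muln1 in lg'; last by apply/eqP; rewrite -/(coprime 2 n) coprime2n.
have L0 : (0 < 2 * lcmn m 2)%N by rewrite muln_gt0 lcmn_gt0 (ltnW m1).
rewrite lg'; congr (_%:Z - _%:Z + _%:Z)%R; last 1 first.
- by rewrite (_ : 2 * 2 * (m * n) = m * (2 * (2 * n)))%N ?mulnK ?muln_gt0 ?(ltnW n1) //; nia.
- by rewrite (_ : 2 * 2 * (m * n) = n * gcdn m 2 * (2 * lcmn m 2))%N ?mulnK //; nia.
by rewrite mulKn.
Qed.

End DihedralMaps.

(** * The two infinite families *)

Local Open Scope ring_scope.

Theorem theorem1p3 :
  (exists M : nat -> surface_map,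
     injective (fun k : nat => euler_char (M k)) /\
     forall k : nat,
       [/\ regular_map (M k),
           square_free (euler_char (M k))
         & exists n : nat,
             (0 < n)%N /\ euler_char (M k) = - (n%:Z * (n%:Z - 2))]) /\
  (exists M : nat -> surface_map,
     injective (fun k : nat => euler_char (M k)) /\
     forall k : nat,
       [/\ regular_map (M k),
           square_free (euler_char (M k))
         & exists n : nat,
             (0 < n)%N /\ euler_char (M k) = - (n%:Z * (n%:Z - 3))]).
Proof.
split.
  have [k|s s_inj s_sqf] := @unbounded_injective_sequence
      (fun i => sqfree (6 * i + 5) && sqfree (6 * i + 7))%N.
    exact: sqfree_progressions.
  pose n k := (6 * s k + 7)%N.
  have n1 k : (1 < n k)%N by rewrite /n; lia.
  have n_odd k : odd (n k) by rewrite /n; lia.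
  pose M k := s2val (dihedral_product_map (n1 k) (n1 k) (n_odd k)).
  have M_reg k : regular_map (M k) by rewrite /M; case: dihedral_product_map.
  have chiM k : euler_char (M k) = - ((6 * s k + 7) * (6 * s k + 5))%N%:Z.
    rewrite /M; case: dihedral_product_map => /= M0 _ ->.
    have /eqP -> : coprime (n k) 2 by rewrite coprimen2.
    rewrite /n; nia.
  exists M; split=> [k l|k]; first by rewrite !chiM => eq_chi; apply: s_inj; nia.
  split=> //; rewrite chiM; last by exists (n k); split; rewrite /n; nia.
  apply: square_free_opp_nat; first by nia.
  have /andP[sq5 sq7] := s_sqf k; apply: sqfreeM => //; try lia.
  (* The two factors are odd and differ by 2. *)
  rewrite (_ : 6 * s k + 7 = (6 * s k + 5) + 2)%N; last by lia.
  by rewrite coprime_sym /coprime gcdnDl -/(coprime _ 2) coprimen2; lia.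
have [k|s s_inj s_sqf] := @unbounded_injective_sequence
    (fun i => sqfree (6 * i + 7) && sqfree (12 * i + 11))%N.
  exact: sqfree_progressions.
(* These are [j + 2] and [4 * j + 3] for [j = 6 * s k + 6]. *)
pose m k := (6 * s k + 8)%N; pose n k := (24 * s k + 27)%N.
have m1 k : (1 < m k)%N by rewrite /m; lia.
have n1 k : (1 < n k)%N by rewrite /n; lia.
have n_odd k : odd (n k) by rewrite /n; lia.
pose M k := s2val (dihedral_product_map (m1 k) (n1 k) (n_odd k)).
have M_reg k : regular_map (M k) by rewrite /M; case: dihedral_product_map.
have chiM k : euler_char (M k) = - (2 * ((6 * s k + 7) * (12 * s k + 11)))%N%:Z.
  rewrite /M; case: dihedral_product_map => /= M0 _ ->.
  have /gcdn_idPr -> : (2 %| m k)%N by rewrite /m; lia.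
  rewrite /m /n; nia.
exists M; split=> [k l|k]; first by rewrite !chiM => eq_chi; apply: s_inj; nia.
split=> //; rewrite chiM; last by exists (12 * s k + 14)%N; split; nia.
apply: square_free_opp_nat; first by nia.
have /andP[sq7 sq11] := s_sqf k.
apply: sqfreeM => //; try nia.
  by rewrite coprime2n; lia.
apply: sqfreeM => //; try lia.
(* Two Euclidean steps reduce the gcd to that of [3] and [6 * s k + 4], which is 1 modulo 3. *)
rewrite (_ : 12 * s k + 11 = (6 * s k + 7) + (6 * s k + 4))%N; last by lia.
rewrite (_ : 6 * s k + 7 = (6 * s k + 4) + 3)%N; last by lia.
rewrite /coprime gcdnDl gcdnC gcdnDl gcdnC -/(coprime 3 _) prime_coprime //.
by lia.
Qed.
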